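(* Let $\pi$ be a permutation of length $n>2$ with exactly one descent, and write $\mu(\pi)=\mu(1,\pi)$. Then: (1) If $\mu(\pi)\neq0$, then $\mu(\pi)>0$ if and only if $n$ is odd. (2) If $\pi_1\pi_2=12$ or $\pi_{n-1}\pi_n=(n-1)n$, then $\mu(\pi)=0$. (3) If $\pi$ has a triple adjacency, then $\mu(\pi)=0$. (4) If $\pi$ has more than two adjacency pairs, then $\mu(\pi)=0$. (5) If $\pi$ has exactly two adjacency pairs: (a) if the first (leftmost) adjacency pair has greater value than the second, then $|\mu(\pi)|=1$; (b) if the first has lower value than the second, then $\mu(\pi)=0$. (6) If $\pi$ has exactly one adjacency pair, at position $i\in\{1,\dots,n-1\}$, and the descent is at position $d$, then: (a) if $i<d$ and $\pi_1\neq1$, $|\mu(\pi)|=i$; (b) if $i<d$ and $\pi_1=1$, $|\mu(\pi)|=i-1$; (c) if $i>d$ and $\pi_n\neq n$, $|\mu(\pi)|=n-i$; (d) if $i>d$ and $\pi_n=n$, $|\mu(\pi)|=n-i-1$. (7) If $\pi$ has no adjacency pairs, then: (a) if $n$ is even and $\pi_1=1$ (so $\pi=W_n$), $\mu(\pi)=-\binom{n/2}{2}$; (b) if $n$ is even and $\pi_1=2$ (so $\pi=M_n$), $\mu(\pi)=-\binom{n/2+1}{2}$; (c) if $n$ is odd, $\mu(\pi)=\binom{(n+1)/2}{2}$. (Where several cases apply simultaneously they give the same value.)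
   Context: A permutation of length $n$ is an arrangement $\pi=\pi_1\cdots\pi_n$ of $1,\dots,n$; $1$ denotes the permutation of length one. The permutation poset is ordered by pattern containment: $\sigma\le\pi$ if $\pi$ has a subsequence in the same relative order as $\sigma$. $\mu$ is its Möbius function: $\mu(a,a)=1$, $\mu(a,b)=-\sum_{a\le z<b}\mu(a,z)$ for $a<b$, $\mu(a,b)=0$ if $a\not\le b$. A descent is an index $d$ with $\pi_d>\pi_{d+1}$. An adjacency pair at position $i$ is an index $i$ with $\pi_{i+1}=\pi_i+1$; its value is $\pi_i$. A triple adjacency is an index $i$ with $\pi_{i+1}=\pi_i+1$ and $\pi_{i+2}=\pi_i+2$ (it consists of two adjacency pairs). The number of adjacency pairs is the number of indices $i$ with $\pi_{i+1}=\pi_i+1$. $M_n$ is the permutation listing the even numbers $2,4,\dots$ in increasing order followed by the odd numbers $1,3,\dots$ in increasing order (e.g. $M_6=246135$); $W_n$ lists the odd numbers in increasing order followed by the even numbers in increasing order (e.g. $W_5=13524$). *)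

(* Defs.v *)
From mathcomp Require Import all_boot all_order all_algebra.
Set Implicit Arguments. Unset Strict Implicit. Unset Printing Implicit Defensive.
Import Order.TTheory GRing.Theory Num.Theory.

Definition is_perm (s : seq nat) : bool := perm_eq s (iota 1 (size s)).

(* Standardisation: replace each entry by its rank (1-based) in s.
   For a sequence with distinct entries, std s is the unique permutation
   in the same relative order as s. *)
Definition std (s : seq nat) : seq nat :=
  [seq count (fun y => y <= x) s | x <- s].

Definition contains (sigma pi : seq nat) : bool :=
  [exists m : (size pi).-tuple bool, std (mask m pi) == sigma].

Definition patterns (pi : seq nat) : seq (seq nat) :=
  undup [seq std (mask (val m) pi) | m <- enum {: (size pi).-tuple bool}].

(* Moebius function of the pattern poset, by the recursion
   mu(a,a)=1, mu(a,b) = - sum_{a <= z < b} mu(a,z), mu(a,b)=0 if a not<= b.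
   The fuel [k] bounds the recursion depth; proper patterns of b are shorter. *)
Fixpoint mu_fuel (k : nat) (sigma pi : seq nat) : int :=
  if pi == sigma then 1%R
  else if ~~ contains sigma pi then 0%R
  else match k with
       | 0 => 0%R
       | k'.+1 => (- \sum_(z <- patterns pi | (z != pi) && contains sigma z)
                      mu_fuel k' sigma z)%R
       end.

Definition mobius (sigma pi : seq nat) : int := mu_fuel (size pi) sigma pi.

Definition mu1 (pi : seq nat) : int := mobius [:: 1] pi.

Definition entry (pi : seq nat) (i : nat) : nat := nth 0 pi i.-1.

Definition descents (pi : seq nat) : seq nat :=
  [seq d <- iota 1 (size pi).-1 | entry pi d.+1 < entry pi d].

Definition adjacencies (pi : seq nat) : seq nat :=
  [seq i <- iota 1 (size pi).-1 | entry pi i.+1 == (entry pi i).+1].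

Definition has_triple_adjacency (pi : seq nat) : bool :=
  has (fun i => (entry pi i.+1 == (entry pi i).+1) &&
                (entry pi i.+2 == (entry pi i).+2))
      (iota 1 (size pi).-2).

(* Main.v *)
Require Import Defs.
From mathcomp Require Import all_boot all_order all_algebra.
From mathcomp Require Import zify ring.
Import Order.TTheory GRing.Theory Num.Theory.
Set Implicit Arguments. Unset Strict Implicit. Unset Printing Implicit Defensive.

(** A permutation [pi] with at most one descent is encoded by the binary word
    whose letter at value [v] tells whether [v] lies after the descent.  Under
    this encoding pattern containment becomes the subword order, except that
    all words [0^a 1^b] of the same length are identified with an increasing
    permutation.  In the subword order, the sum over all subwords [z] of [w] of
    [(-1)^|z|] times the number of normal embeddings of [u] in [z] vanishes for
    [u != w] (Björner): splitting off the first letter [a] of [w], the subwords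
    that do not start with [a] cancel the embeddings in [a :: z] that leave out
    [a].  With the corrections [+1] at [1] and [-1] at [12] for the identified
    words, the recursion defining the Möbius function gives
    [mu(1, pi) = (-1)^(n-1) * (number of normal embeddings of 10)], i.e. up to
    sign the number of inversions [(j, k)] of [pi] such that every adjacency
    pair starts at [j] or at [k].  These are counted using that, away from
    adjacency pairs, the letters alternate, so that the entries before (or
    after) the descent increase in steps of two. *)

(** * Subwords, normal embeddings and their alternating sum *)

Section Subwords.
Variable T : eqType.
Implicit Types (u w z : seq T).

(** Subwords starting with [a] already occur in the first summand; filtering them out of the second
    makes the list duplicate-free, as signed sums over it require. *)
Fixpoint subwords w : seq (seq T) :=
  if w is a :: w' then
    [seq a :: z | z <- subwords w'] ++ [seq z <- subwords w' | ohead z != Some a]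
  else [:: [::]].

Lemma mem_subwords w z : (z \in subwords w) = subseq z w.
Proof.
elim: w z => [|a w IH] [|b z] //=; rewrite mem_cat mem_filter IH.
  by rewrite sub0seq orbT.
rewrite /= (inj_eq (@Some_inj _)); case: (eqVneq b a) => [-> | ba] /=.
  by rewrite orbF mem_map ?IH // => x y [].
by case: mapP => // -[x _ [/eqP]]; rewrite (negbTE ba).
Qed.

Lemma subwords_uniq w : uniq (subwords w).
Proof.
elim: w => //= a w IH; rewrite cat_uniq filter_uniq // map_inj_uniq; last first.
  by move=> x y [].
rewrite IH andbT; apply/hasPn => z; rewrite mem_filter => /andP[hz _].
by apply/mapP => -[x _ zE]; rewrite zE eqxx in hz.
Qed.

(* Normal embeddings of [u] in [z]: every letter of [z] that is followed by an
   equal letter has to be used (Björner uses the mirror-image convention). *)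
Fixpoint normal_embeddings u z : nat :=
  if z is a :: z' then
    (if u is b :: u' then (b == a) * normal_embeddings u' z' else 0)
    + (ohead z' != Some a) * normal_embeddings u z'
  else u == [::].

Lemma sum_normal_embeddings u w :
  (\sum_(z <- subwords w) (-1) ^+ size z * (normal_embeddings u z)%:Z
   = (u == w)%:Z * (-1) ^+ size u)%R.
Proof.
elim: w u => [|a w IH] u.
  by rewrite big_seq1 mul1r; case: u => [|b u] //=; rewrite mul0r.
rewrite /= big_cat /= big_map big_filter [X in (_ + X)%R]big_mkcond /= -big_split /=.
transitivity (\sum_(z <- subwords w) - ((-1) ^+ size z *
   (if u is b :: u' then (b == a) * normal_embeddings u' z else 0)%N%:Z))%R.
  apply: eq_bigr => z _; rewrite exprS PoszD.
  by case: ifP => _ /=; [rewrite mul1n|rewrite mul0n]; ring.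
case: u => [|b u]; first by rewrite big1 // => z _; rewrite mulr0 oppr0.
rewrite sumrN eqseq_cons; case: eqP => _ /=.
  under eq_bigr do rewrite mul1n.
  by rewrite IH exprS; ring.
by rewrite mul0r big1 ?oppr0 // => z _; rewrite mul0n mulr0.
Qed.

End Subwords.

(** * Normal embeddings of words of length at most two, by positions *)

Definition repeats (w : seq bool) : seq nat :=
  [seq v <- iota 0 (size w).-1 | nth false w v == nth false w v.+1].

Lemma repeats_cons x w :
  repeats (x :: w) = nseq (ohead w == Some x) 0 ++ map S (repeats w).
Proof.
case: w => [|y w] //; rewrite /repeats /= (iotaDl 1 0) filter_map.
by rewrite (inj_eq (@Some_inj _)) eq_sym; case: eqP.
Qed.

Lemma normal_embeddings0 w :
  normal_embeddings [::] w = (repeats w == [::]) :> nat.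
Proof.
elim: w => //= x w ->; rewrite repeats_cons.
by case: eqP => //=; rewrite add0n ?mul1n //; case: (repeats w).
Qed.

Lemma normal_embeddings1 c w :
  normal_embeddings [:: c] w =
  \sum_(b < size w) ((nth false w b == c) && all (pred1 (b : nat)) (repeats w)).
Proof.
elim: w => [|x w IH]; first by rewrite big_ord0.
rewrite [LHS]/= normal_embeddings0 IH big_ord_recl repeats_cons all_cat all_map /=.
congr (_ + _).
  rewrite all_nseq orbT /= eq_sym -mulnb; congr (_ * _).
  by case: (repeats w).
rewrite big_distrr; apply: eq_bigr => b _; rewrite /= all_cat all_map all_nseq /=.
by case: (ohead w == Some x) => /=; rewrite ?andbF // mul1n.
Qed.

(** An embedding is a choice of positions, and it is normal exactly when every repeat is among them.
    Induction on [w] splits on whether its first letter is used. *)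
Lemma normal_embeddings2 c c' w :
  normal_embeddings [:: c; c'] w =
  \sum_(a < size w) \sum_(b < size w)
    [&& a < b, nth false w a == c, nth false w b == c'
      & all (mem [:: nat_of_ord a; nat_of_ord b]) (repeats w)].
Proof.
elim: w => [|x w IH]; first by rewrite big_ord0.
rewrite [LHS]/= normal_embeddings1 IH [RHS]big_ord_recl; congr (_ + _).
  rewrite big_ord_recl add0n big_distrr; apply: eq_bigr => b _.
  rewrite /= repeats_cons all_cat all_nseq all_map /= inE eqxx orbT /= eq_sym.
  rewrite mulnb; congr (nat_of_bool [&& _, _ & _]).
  by apply: eq_all => v /=; rewrite !inE.
rewrite big_distrr; apply: eq_bigr => a _.
rewrite big_ord_recl /= add0n big_distrr; apply: eq_bigr => b _ /=.
(* A repeat at position [0] is missed by shifted positions, which matches the factor forbidding to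
   skip the first letter. *)
rewrite /bump /= !add1n ltnS repeats_cons all_cat all_nseq all_map /= !inE /=.
by case: (ohead w == Some x); rewrite /= ?andbF // mul1n.
Qed.

(** * The encoding of permutations by binary words *)

Definition unshuffle (t : seq (nat * bool)) : seq nat :=
  [seq x.1 | x <- t & ~~ x.2] ++ [seq x.1 | x <- t & x.2].

Definition word_perm (w : seq bool) : seq nat :=
  unshuffle (zip (iota 1 (size w)) w).

(** Without a descent the default [0] makes [drop] keep all of [p], so the word is constantly [true]
    and contains no [10]. *)
Definition perm_word (p : seq nat) : seq bool :=
  [seq v \in drop (head 0 (descents p)) p | v <- iota 1 (size p)].

Lemma perm_unshuffle t : perm_eq (unshuffle t) (unzip1 t).
Proof.
rewrite /unshuffle -map_cat; apply: perm_map.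
by rewrite perm_catC perm_filterC.
Qed.

(** As the labels are distinct, [s] is determined by its set of entries, so keeping the pairs of [t]
    with label in [s] works. *)
Lemma subseq_unshuffle t s : uniq (unzip1 t) -> subseq s (unshuffle t) ->
  exists2 t', subseq t' t & s = unshuffle t'.
Proof.
move=> tU st; exists [seq x <- t | x.1 \in s]; first exact: filter_subseq.
have stU : uniq (unshuffle t) by rewrite (perm_uniq (perm_unshuffle t)).
rewrite {1}(elimT (subseq_uniqP stU) st) /unshuffle filter_cat !filter_map -!filter_predI.
by congr (_ ++ _); congr map; apply: eq_filter => x /=; rewrite andbC.
Qed.

Lemma unshuffle_subseq t' t : subseq t' t -> subseq (unshuffle t') (unshuffle t).
Proof.
move=> tt'; rewrite /unshuffle cat_subseq // map_subseq // subseq_filter filter_all;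
  exact: subseq_trans (filter_subseq _ _) tt'.
Qed.

Lemma size_unshuffle t : size (unshuffle t) = size t.
Proof. by rewrite (perm_size (perm_unshuffle t)) size_map. Qed.

Lemma ranks_sorted s : sorted ltn s ->
  [seq count (fun y => y <= x) s | x <- s] = iota 1 (size s).
Proof.
elim: s => // a s IH /= as_; have sS := path_sorted as_.
have a_lt := order_path_min ltn_trans as_.
rewrite leqnn; congr (_ :: _).
  apply/eqP; rewrite addn_eq1; apply/orP; left; rewrite eqxx /= -leqn0 leqNgt -has_count.
  by apply/hasPn => y ys; rewrite -ltnNge (allP a_lt).
rewrite (iotaDl 1 1) -IH // -map_comp; apply/eq_in_map => x xs /=.
by rewrite ltnW // (allP a_lt).
Qed.

(** Ranks depend only on the set of labels, and in the sorted list [unzip1 t] the rank of a label is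
    its position; only the letters survive standardisation. *)
Lemma std_unshuffle t : sorted ltn (unzip1 t) ->
  std (unshuffle t) = word_perm (unzip2 t).
Proof.
move=> tS; pose rank x := count (fun y => y <= x) (unzip1 t).
have -> : std (unshuffle t) = map rank (unshuffle t).
  by apply: eq_map => x; apply/permP/perm_unshuffle.
have -> : word_perm (unzip2 t) = unshuffle [seq (rank x.1, x.2) | x <- t].
  congr unshuffle; rewrite size_map -(size_map fst) -ranks_sorted // -/(unzip1 t).
  by rewrite -map_comp zip_map; apply: eq_map.
by rewrite /unshuffle map_cat !filter_map -!map_comp.
Qed.

Lemma size_word_perm w : size (word_perm w) = size w.
Proof. by rewrite size_unshuffle size_zip size_iota minnn. Qed.

Lemma mem_patterns z p :
  reflect (exists2 s, subseq s p & z = std s) (z \in patterns p).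
Proof.
rewrite mem_undup; apply: (iffP mapP) => [[m _ ->] | [s /subseqP[m sm ->] ->]].
  by exists (mask m p) => //; apply: mask_subseq.
by exists (Tuple (introT eqP sm)); rewrite ?mem_enum.
Qed.

(** Subsequences of the permutation are the unshuffled sublists of its labelled word. Only
    membership is compared, because different words can give the same increasing permutation. *)
Lemma mem_patterns_word_perm w :
  patterns (word_perm w) =i map word_perm (subwords w).
Proof.
have zipS : sorted ltn (unzip1 (zip (iota 1 (size w)) w)).
  by rewrite unzip1_zip ?size_iota ?iota_ltn_sorted.
have zip2 : unzip2 (zip (iota 1 (size w)) w) = w.
  by rewrite unzip2_zip ?size_iota.
move=> z; apply/mem_patterns/mapP => [[s sw ->] | [u]].
  have [|t tw ->] := subseq_unshuffle _ sw.
    by apply: sorted_uniq zipS; [apply: ltn_trans | apply: ltnn].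
  exists (unzip2 t); first by rewrite mem_subwords -zip2 map_subseq.
  apply: std_unshuffle; apply: subseq_sorted zipS; first exact: ltn_trans.
  exact: map_subseq.
rewrite mem_subwords => /subseqP[m mw ->] ->.
exists (unshuffle (mask m (zip (iota 1 (size w)) w))).
  exact/unshuffle_subseq/mask_subseq.
rewrite std_unshuffle /unzip2 ?map_mask -?/(unzip2 _) ?zip2 //.
rewrite /unzip1 map_mask; apply: subseq_sorted zipS; first exact: ltn_trans.
exact: mask_subseq.
Qed.

(** * Descents, and recovering the word from the permutation *)

Lemma nth_sorted_ltn s i j : sorted ltn s -> i < size s -> j < size s ->
  (nth 0 s i < nth 0 s j) = (i < j).
Proof.
move=> sS si sj; have [ij|ji|->] := ltngtP i j; last by rewrite ltnn.
  exact: (sorted_ltn_nth ltn_trans 0 sS).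
apply/negbTE; rewrite -leqNgt ltnW //.
exact: (sorted_ltn_nth ltn_trans 0 sS).
Qed.

Lemma mem_descents p d :
  (d \in descents p) = [&& 0 < d, d < size p & nth 0 p d < nth 0 p d.-1].
Proof.
rewrite mem_filter mem_iota andbC /entry add1n.
by case: (size p) => [|n]; case: d => //= d; rewrite andbF.
Qed.

Lemma descents_uniq p : uniq (descents p).
Proof. by rewrite filter_uniq ?iota_uniq. Qed.

Lemma descents_sorted s : sorted ltn s -> descents s = [::].
Proof.
move=> sS; case E: (descents s) => [|d l] //.
have : d \in descents s by rewrite E inE eqxx.
by rewrite mem_descents => /and3P[d0 dn]; rewrite nth_sorted_ltn //; lia.
Qed.

Lemma descents_cat A B : sorted ltn A -> sorted ltn B ->
  0 < size A -> 0 < size B -> head 0 B < last 0 A -> descents (A ++ B) = [:: size A].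
Proof.
move=> sA sB A0 B0 AB; apply: perm_small_eq => //; apply: uniq_perm => [||d] //.
  exact: descents_uniq.
rewrite mem_descents size_cat inE !nth_cat.
case: (ltngtP d (size A)) => [dA|Ad|->].
- rewrite ifT; last by lia.
  by rewrite nth_sorted_ltn //; lia.
- rewrite ifF; last by lia.
  case: (ltnP d (size A + size B)) => dn; last by rewrite andbF.
  by rewrite nth_sorted_ltn //; lia.
- rewrite subnn nth0 ifT; last by lia.
  rewrite nth_last AB; lia.
Qed.

Lemma head_lt_last A B a b : sorted ltn A -> sorted ltn B ->
  a \in B -> b \in A -> a < b -> head 0 B < last 0 A.
Proof.
case: B => // h B; rewrite (sorted_pairwise ltn_trans) => + /= BS; rewrite inE.
case/lastP: A => // A l; rewrite pairwise_rcons last_rcons mem_rcons inE.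
move=> /andP[Al _] aB bA ab; apply: (@leq_ltn_trans a); last apply: (leq_trans ab).
  by case/predU1P: aB => [->|aB] //; apply/ltnW/(allP (order_path_min ltn_trans BS)).
by case/predU1P: bA => [->|bA] //; apply/ltnW/(allP Al).
Qed.

Lemma unshuffle_sorted t : sorted ltn (unzip1 t) ->
  sorted ltn [seq x.1 | x <- t & ~~ x.2] /\ sorted ltn [seq x.1 | x <- t & x.2].
Proof.
by move=> tS; split; apply: subseq_sorted tS;
  (exact: ltn_trans || exact/map_subseq/filter_subseq).
Qed.

(** An occurrence of [10] is a label of the second block below a label of the first; both blocks
    being increasing, this forces a descent where they meet. *)
Lemma descents_unshuffle t : sorted ltn (unzip1 t) ->
  subseq [:: true; false] (unzip2 t) ->
  descents (unshuffle t) = [:: count (fun x => ~~ x.2) t].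
Proof.
move=> tS /subseqP[m mt tm]; have [AS BS] := unshuffle_sorted tS.
have [a [b [aB bA ab]]] : exists a b, [/\ a \in [seq x.1 | x <- t & x.2],
    b \in [seq x.1 | x <- t & ~~ x.2] & a < b].
  have : sorted ltn (unzip1 (mask m t)).
    by rewrite /unzip1 map_mask; apply: subseq_sorted tS;
      [exact: ltn_trans | exact: mask_subseq].
  have : subseq (mask m t) t by exact: mask_subseq.
  move/mem_subseq; move: tm; rewrite -map_mask.
  case: (mask m t) => [|[a x] [|[b y] [|]]] //= [<- <-].
  move=> sub; rewrite andbT => ab; exists a, b; split=> //.
    by apply/mapP; exists (a, true); rewrite // mem_filter sub ?inE ?eqxx.
  by apply/mapP; exists (b, false); rewrite // mem_filter sub ?inE ?eqxx ?orbT.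
rewrite descents_cat ?size_map ?size_filter //.
- by case/mapP: bA => x; rewrite -has_count mem_filter => /andP[x2 xt] _;
  apply/hasP; exists x.
- by case/mapP: aB => x; rewrite -has_count mem_filter => /andP[x2 xt] _;
  apply/hasP; exists x.
exact: head_lt_last AS BS aB bA ab.
Qed.

Lemma word_perm_increasing w :
  ~~ subseq [:: true; false] w -> word_perm w = iota 1 (size w).
Proof.
(* The starting value is generalised because removing a leading [false] shifts the labels. *)
rewrite /word_perm; move: 1; elim: w => //= -[|] w IH m; last first.
  by move=> w10; rewrite /unshuffle /= -[in RHS](IH m.+1 w10).
rewrite eqxx sub1seq => wF.
have {}wF : all id w by apply/allP => -[|] //; rewrite (negbTE wF).
have tF n : all (fun x => x.2) (zip (iota n (size w)) w).
  by elim: w wF n {IH} => //= b w IH /andP[-> /IH] + n => ->.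
rewrite /unshuffle /= (all_filterP (tF _)).
rewrite -[map _ (zip _ _)]/(unzip1 _) unzip1_zip ?size_iota //.
rewrite [X in map _ X](_ : _ = [::]) //.
by apply/eqP; rewrite -(negbK (_ == _)) -has_filter has_predC (tF _).
Qed.

Lemma word_of_labels (vs : seq nat) (w : seq bool) : size vs = size w -> uniq vs ->
  [seq v \in [seq x.1 | x <- zip vs w & x.2] | v <- vs] = w.
Proof.
elim: vs w => [|v vs IH] [|b w] //= [szE] /andP[vvs vsU].
have sub : {subset [seq x.1 | x <- zip vs w & x.2] <= vs}.
  have {2}-> : vs = unzip1 (zip vs w) by rewrite unzip1_zip ?szE.
  exact/mem_subseq/map_subseq/filter_subseq.
case: b => /=; last by rewrite (contraNF (sub v)) ?IH.
rewrite inE eqxx -[in RHS](IH w) //; congr (_ :: _); apply/eq_in_map => x xvs.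
by rewrite inE; case: eqP => // xv; rewrite -xv xvs in vvs.
Qed.

(** The hypothesis excludes the words [0^a 1^b], whose increasing permutation does not remember
    [a]. *)
Lemma word_permK w : subseq [:: true; false] w -> perm_word (word_perm w) = w.
Proof.
move=> w10; have zs : size w <= size (iota 1 (size w)) by rewrite size_iota.
have wE : unzip2 (zip (iota 1 (size w)) w) = w by rewrite unzip2_zip ?size_iota.
rewrite /perm_word descents_unshuffle ?wE //; last first.
  by rewrite unzip1_zip ?size_iota ?iota_ltn_sorted.
rewrite size_word_perm /= drop_size_cat ?size_map ?size_filter //.
by rewrite word_of_labels ?size_iota ?iota_uniq.
Qed.

(** * The Möbius function as a signed number of normal embeddings of [10] *)

Lemma normal_embeddings_nsubseq (T : eqType) (u w : seq T) :
  ~~ subseq u w -> normal_embeddings u w = 0.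
Proof.
elim: w u => [|a w IH] [|b u] //= nsub.
rewrite [X in _ + _ * X]IH ?muln0 ?addn0; last first.
  by apply: contraNN nsub; case: eqP => // _; apply: subseq_trans; apply: subseq_cons.
by case: eqVneq nsub => // _ nsub; rewrite IH.
Qed.

Lemma normal_embeddings_perm_word_increasing w : ~~ subseq [:: true; false] w ->
  normal_embeddings [:: true; false] (perm_word (word_perm w)) = 0.
Proof.
move/word_perm_increasing->; rewrite /perm_word descents_sorted ?iota_ltn_sorted //.
rewrite drop0 size_iota normal_embeddings_nsubseq //.
apply/negP => /mem_subseq/(_ false); rewrite !inE => /(_ isT)/mapP[v vn].
by rewrite vn.
Qed.

(** The candidate for [mu(1, p)], written through [perm_word] so that it is a function of the
    permutation and not of a chosen word. *)
Definition mu1_value (p : seq nat) : int :=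
  ((p == [:: 1])%:Z - (p == [:: 1; 2])%:Z
   - (-1) ^+ size p * (normal_embeddings [:: true; false] (perm_word p))%:Z)%R.

(** Meant for [word_perm], which is injective on words containing [10]; the words it identifies
    carry weight zero. *)
Lemma sum_undup_map (S T : eqType) (f : S -> T) (g : T -> int) s : uniq s ->
  {in [pred x | g (f x) != 0%R] &, injective f} ->
  (\sum_(y <- undup (map f s)) g y = \sum_(x <- s) g (f x))%R.
Proof.
move=> sU finj; rewrite (bigID (fun y => g y == 0%R)) /= big1 ?add0r; last first.
  by move=> y /eqP.
rewrite [RHS](bigID (fun x => g (f x) == 0%R)) /= [X in (X + _)%R]big1 ?add0r; last first.
  by move=> y /eqP.
rewrite -big_filter -[RHS]big_filter filter_undup filter_map undup_id ?big_map //.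
rewrite map_inj_in_uniq ?filter_uniq // => x y.
by rewrite !mem_filter => /andP[hx _] /andP[hy _]; apply: finj.
Qed.

Lemma sum_eq_indicator (T : eqType) (v : T) s : uniq s ->
  (\sum_(z <- s) (z == v)%:Z = (v \in s)%:Z)%R.
Proof.
elim: s => [|x s IH] /=; first by rewrite big_nil.
move=> /andP[xs /IH IHs]; rewrite big_cons IHs inE [x == v]eq_sym.
by case: eqVneq xs => //= ->; case: (x \in s).
Qed.

Lemma sum_signed_embeddings w :
  (\sum_(z <- patterns (word_perm w))
     (-1) ^+ size z * (normal_embeddings [:: true; false] (perm_word z))%:Z
   = (w == [:: true; false])%:Z)%R.
Proof.
have valE u : normal_embeddings [:: true; false] (perm_word (word_perm u))
            = normal_embeddings [:: true; false] u.
  case: (boolP (subseq [:: true; false] u)) => [/word_permK->//|nsub].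
  by rewrite normal_embeddings_perm_word_increasing // normal_embeddings_nsubseq.
rewrite (perm_big (undup (map word_perm (subwords w)))); last first.
  by apply: uniq_perm => [||z]; rewrite ?undup_uniq // mem_undup mem_patterns_word_perm.
rewrite sum_undup_map ?subwords_uniq //; last first.
  have nz u : u \in [pred x | ((-1) ^+ size (word_perm x) *
      (normal_embeddings [:: true; false] (perm_word (word_perm x)))%:Z)%R != 0%R] ->
      perm_word (word_perm u) = u.
    rewrite inE valE => nz; apply: word_permK; apply: contraNT nz => nsub.
    by rewrite normal_embeddings_nsubseq ?mulr0.
  by move=> x y /nz {2}<- /nz {2}<- ->.
under eq_bigr do rewrite valE size_word_perm.
by rewrite sum_normal_embeddings eq_sym mulr1.
Qed.

Lemma mem12_patterns w : 1 < size w ->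
  ([:: 1; 2] \in patterns (word_perm w)) = (w != [:: true; false]).
Proof.
rewrite mem_patterns_word_perm => w1; apply/mapP/idP => [[u]|].
  by rewrite mem_subwords => uw uE; apply: contraTneq uw => wE;
    case: u uE => [|[] [|[] [|]]] //; rewrite wE.
case: w w1 => [|a [|b w]] // _.
case: (boolP ((a, b) == (true, false))) => [/eqP[-> ->]|ab _].
  (* After [10], any third letter [c] yields the subword [0c], hence the pattern [12]. *)
  case: w => [|c w] // _; exists [:: false; c]; last by case: c.
  by rewrite mem_subwords /= eqxx sub0seq.
exists [:: a; b]; first by rewrite mem_subwords /= !eqxx sub0seq.
by case: a b ab => [] [].
Qed.

Lemma mem1_patterns w : 0 < size w -> [:: 1] \in patterns (word_perm w).
Proof.
case: w => // a w _; rewrite mem_patterns_word_perm; apply/mapP.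
exists [:: a]; last by case: a.
by rewrite mem_subwords /= eqxx sub0seq.
Qed.

(** The three terms sum to [1], [-[w != 10]] and [-[w = 10]], so the candidate satisfies the Möbius
    recursion. *)
Lemma sum_mu1_value w : 1 < size w ->
  (\sum_(z <- patterns (word_perm w)) mu1_value z = 0)%R.
Proof.
move=> w1; rewrite big_split sumrN big_split sumrN /=.
rewrite sum_signed_embeddings !sum_eq_indicator ?undup_uniq //.
by rewrite mem12_patterns // mem1_patterns 1?ltnW //; case: eqP.
Qed.

Lemma contains_patterns sigma p : contains sigma p = (sigma \in patterns p).
Proof.
rewrite mem_undup; apply/existsP/mapP => [[m /eqP]|[m _ ->]]; last by exists m.
by exists m; rewrite ?mem_enum.
Qed.

Lemma contains1_word_perm w : contains [:: 1] (word_perm w) = (0 < size w).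
Proof.
rewrite contains_patterns; case: (ltnP 0 (size w)) => [/mem1_patterns->//|].
by rewrite leqn0 size_eq0 => /eqP->; rewrite mem_patterns_word_perm.
Qed.

(** Proper patterns come from strictly shorter subwords, so fuel [size w] suffices and the recursion
    determines the value; lengths below two are checked directly. *)
Lemma mu_fuel_word_perm k w : size w <= k ->
  mu_fuel k [:: 1] (word_perm w) = mu1_value (word_perm w).
Proof.
elim: k w => [|k IH] w wk.
  by move: wk; rewrite leqn0 size_eq0 => /eqP->; rewrite /= contains1_word_perm.
rewrite /=; case: eqVneq => [->//|w1]; rewrite contains1_word_perm.
have [|w0] := ltnP 0 (size w); last by move: w0; rewrite leqn0 size_eq0 => /eqP->.
rewrite leq_eqVlt => /predU1P[w1E|w2].
  by case: w w1E w1 {wk} => [|[] []].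
have wP : word_perm w \in patterns (word_perm w).
  by rewrite mem_patterns_word_perm map_f // mem_subwords.
have := sum_mu1_value w2; rewrite (bigD1_seq _ wP) ?undup_uniq //= => /eqP.
rewrite addr_eq0 => /eqP->; congr (- _)%R.
rewrite big_mkcond [RHS]big_mkcond /= big_seq [RHS]big_seq; apply: eq_bigr => z.
rewrite mem_patterns_word_perm => /mapP[u]; rewrite mem_subwords => uw ->.
rewrite contains1_word_perm; case: eqVneq => //= uwE.
(* The recursion leaves out the empty pattern, where [mu1_value] vanishes. *)
have [_|] := ltnP 0 (size u); last by rewrite leqn0 size_eq0 => /eqP->.
apply: IH; rewrite -ltnS; apply: leq_trans wk.
rewrite ltn_neqAle size_subseq // andbT; apply: contra uwE => /eqP szE.
by move: (size_subseq_leqif uw) => [_]; rewrite szE eqxx => /esym/eqP->.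
Qed.

(** * From words back to a permutation with one descent: inversions covering the adjacency pairs *)

Section OneDescent.
Variables (pi : seq nat) (d : nat).
Hypotheses (pi_perm : is_perm pi) (pi_descent : descents pi = [:: d]).
Local Notation n := (size pi).

Lemma entries_eq : pi = map (entry pi) (iota 1 n).
Proof.
rewrite (iotaDl 1 0) -map_comp.
apply: (@eq_from_nth _ 0); first by rewrite size_map size_iota.
by move=> i i_n; rewrite (nth_map 0) ?size_iota // nth_iota.
Qed.

Lemma mem_perm v : (v \in pi) = (0 < v <= n).
Proof. by rewrite (perm_mem pi_perm) mem_iota add1n ltnS. Qed.

Lemma perm_entry_bounds i : 0 < i <= n -> 0 < entry pi i <= n.
Proof. by move=> i_n; rewrite -mem_perm mem_nth //; have : i.-1 < n by lia. Qed.

Lemma perm_uniq_seq : uniq pi.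
Proof. by rewrite (perm_uniq pi_perm) iota_uniq. Qed.

Lemma entry_inj i j : 0 < i <= n -> 0 < j <= n -> entry pi i = entry pi j -> i = j.
Proof.
move=> i_n j_n; have i1 : i.-1 < n by lia.
have j1 : j.-1 < n by lia.
move=> /eqP; rewrite (nth_uniq 0 i1 j1 perm_uniq_seq).
move/eqP; lia.
Qed.

Lemma entry_surj v : 0 < v <= n -> exists2 i, 0 < i <= n & entry pi i = v.
Proof.
rewrite -mem_perm => v_pi; exists (index v pi).+1; last exact: nth_index.
by rewrite /= index_mem.
Qed.

Lemma descent_bounds : 0 < d < n.
Proof.
have : d \in descents pi by rewrite pi_descent inE.
by rewrite mem_descents => /and3P[-> -> _].
Qed.

Lemma entry_descent : entry pi d.+1 < entry pi d.
Proof.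
have : d \in descents pi by rewrite pi_descent inE.
by rewrite mem_descents => /and3P[].
Qed.

Lemma entry_succ i : 0 < i < n -> i != d -> entry pi i < entry pi i.+1.
Proof.
move=> /andP[i0 i_n] id; have : i \notin descents pi by rewrite pi_descent inE.
rewrite mem_descents i0 i_n /= -[nth 0 pi i]/(entry pi i.+1) -leqNgt leq_eqVlt.
by case/predU1P=> // /entry_inj; lia.
Qed.

Lemma entry_increasing i j : 0 < i -> i < j -> j <= n -> (j <= d) || (d < i) ->
  entry pi i < entry pi j.
Proof.
move=> i0; elim: j => // j IH; rewrite ltnS leq_eqVlt => /predU1P[<-|ij] j_n ijd.
  by apply: entry_succ; lia.
by apply: (@ltn_trans (entry pi j)); [apply: IH; lia|apply: entry_succ; lia].
Qed.

Lemma inversion_across i j : 0 < i -> i < j -> j <= n -> entry pi j < entry pi i ->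
  i <= d < j.
Proof.
move=> i0 ij jn ji; apply: contraTT ji => ijd; rewrite -leqNgt ltnW //.
by apply: entry_increasing => //; lia.
Qed.

Lemma mem_adjacencies i :
  (i \in adjacencies pi) = [&& 0 < i, i < n & entry pi i.+1 == (entry pi i).+1].
Proof.
rewrite mem_filter mem_iota andbC add1n.
by case: n => [|m]; case: i => //= i; rewrite andbF.
Qed.

(** Each side of the descent increases, so no entry fits between two consecutive values on one side.
    Contrapositively, away from adjacency pairs consecutive values lie on opposite sides. *)
Lemma consecutive_same_side i j : 0 < i <= n -> 0 < j <= n ->
  (i <= d) = (j <= d) -> entry pi j = (entry pi i).+1 -> j = i.+1 /\ i \in adjacencies pi.
Proof.
move=> i_n j_n side ji; suff jE : j = i.+1.
  by split=> //; rewrite mem_adjacencies -jE ji eqxx; lia.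
have [ji'|ij|//] := ltngtP j i.+1.
  have [jE|ji''] : j = i \/ j < i by lia.
    by rewrite jE in ji; lia.
  by have := @entry_increasing j i; lia.
have := @entry_increasing i i.+1; have := @entry_increasing i.+1 j; lia.
Qed.

Lemma mem_drop_entry i : 0 < i <= n -> (entry pi i \in drop d pi) = (d < i).
Proof.
move=> i_n; apply/(nthP 0)/idP => [[k]|di].
  rewrite size_drop nth_drop => kn'; have {kn'}kn : k < n - d by [].
  by rewrite -[nth 0 pi (d + k)]/(entry pi (d + k).+1) => /entry_inj; lia.
exists (i.-1 - d); last by rewrite nth_drop subnKC //; lia.
by rewrite size_drop; have : i.-1 - d < n - d by lia.
Qed.

Lemma size_perm_word : size (perm_word pi) = n.
Proof. by rewrite size_map size_iota. Qed.

Lemma nth_perm_word i : 0 < i <= n ->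
  nth false (perm_word pi) (entry pi i).-1 = (d < i).
Proof.
move=> i_n; have e_n := perm_entry_bounds i_n.
rewrite /perm_word pi_descent /= (nth_map 0) ?size_iota; last by lia.
by rewrite nth_iota ?add1n ?prednK ?mem_drop_entry //; lia.
Qed.

(** On each side of the descent, both permutations list the same values in increasing order. *)
Lemma perm_wordK : word_perm (perm_word pi) = pi.
Proof.
have entriesE : sorted ltn (take d pi) /\ sorted ltn (drop d pi).
  split; apply/(sortedP 0) => i; rewrite ?size_take ?size_drop => i_n.
    rewrite !nth_take; try by move: i_n; case: ifP; lia.
    by apply: (@entry_succ i.+1); move: i_n; case: ifP; lia.
  by rewrite !nth_drop addnS; apply: (@entry_succ (d + i).+1); lia.
rewrite /word_perm size_perm_word /unshuffle /perm_word pi_descent /=.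
have -> : zip (iota 1 n) [seq v \in drop d pi | v <- iota 1 (size pi)]
   = [seq (v, v \in drop d pi) | v <- iota 1 n].
  by rewrite -[X in zip X _]map_id zip_map.
rewrite !filter_map -!map_comp !map_id -[RHS](cat_take_drop d).
have iS := iota_ltn_sorted 1 n; have := perm_uniq_seq.
rewrite -{1}(cat_take_drop d pi) cat_uniq => /and3P[_ /hasPn disj _].
have memE v : (v \in iota 1 n) = (v \in take d pi) || (v \in drop d pi).
  by rewrite -mem_cat cat_take_drop (perm_mem pi_perm).
case: entriesE => AS BS; congr (_ ++ _);
  apply: (irr_sorted_eq ltn_trans ltnn) => //;
  try (apply: (subseq_sorted ltn_trans _ iS); exact: filter_subseq);
  move=> v; rewrite mem_filter memE /=; have := disj v; case: (v \in drop d pi) => //.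
- by move=> /(_ isT) /negbTE.
- by rewrite orbF.
- by rewrite orbT.
Qed.

(** Equal neighbouring letters are consecutive values on one side of the descent, hence neighbours
    in [pi]. The predecessor appears because letters are indexed from [0] and values from [1]. *)
Lemma mem_repeats_perm_word :
  repeats (perm_word pi) =i [seq (entry pi i).-1 | i <- adjacencies pi].
Proof.
move=> v; rewrite mem_filter mem_iota size_perm_word add0n leq0n andTb.
apply/andP/mapP => [[/eqP eqv v_n]|[i + ->]].
  have [i i_n iE] : exists2 i, 0 < i <= n & entry pi i = v.+1 by apply: entry_surj; lia.
  have [j j_n jE] : exists2 j, 0 < j <= n & entry pi j = v.+2 by apply: entry_surj; lia.
  have := nth_perm_word i_n; have := nth_perm_word j_n.
  rewrite iE jE /= -eqv => -> side.
  exists i; last by rewrite iE.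
  by apply: (proj2 (@consecutive_same_side i j _ _ _ _)) => //; [lia|rewrite iE].
rewrite mem_adjacencies => /and3P[i0 i_n /eqP iE].
have e_n : 0 < entry pi i <= n by apply: perm_entry_bounds; lia.
have e'_n : 0 < entry pi i.+1 <= n by apply: perm_entry_bounds; lia.
split; last by lia.
have := @nth_perm_word i; have := @nth_perm_word i.+1; rewrite iE /=.
rewrite prednK; last by lia.
move=> -> // ->; last by lia.
have : i != d by apply/eqP => iE'; have := entry_descent; rewrite -iE' iE; lia.
lia.
Qed.

Definition covering_inversion j k :=
  [&& j < k, entry pi k < entry pi j & all (mem [:: j; k]) (adjacencies pi)].

Lemma normal_embeddings_perm_word :
  normal_embeddings [:: true; false] (perm_word pi) =
  \sum_(j <- iota 1 n) \sum_(k <- iota 1 n) covering_inversion j k.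
Proof.
have iotaE : perm_eq (iota 0 n) [seq (entry pi i).-1 | i <- iota 1 n].
  have -> : iota 0 n = map predn (iota 1 n).
    by rewrite (iotaDl 1 0) -map_comp map_id.
  by rewrite map_comp -entries_eq perm_map // perm_sym.
have reindex (F : nat -> nat) : \sum_(v < n) F v = \sum_(i <- iota 1 n) F (entry pi i).-1.
  by rewrite -(big_mkord xpredT) /index_iota subn0 (perm_big _ iotaE) big_map.
(* The letter [true] comes first in [10]: it is the smaller value, at the later position [k].
   Exchanging the sums puts [j] outside. *)
rewrite normal_embeddings2 size_perm_word exchange_big /=.
pose w := perm_word pi; pose F a b := nat_of_bool [&& a < b, nth false w a == true,
   nth false w b == false & all (mem [:: a; b]) (repeats w)].
transitivity (\sum_(j <- iota 1 n) \sum_(k <- iota 1 n)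
  F (entry pi k).-1 (entry pi j).-1).
  by rewrite -(reindex (fun b => \sum_(k <- _) F (entry pi k).-1 b));
    apply: eq_bigr => b _; rewrite -(reindex (F^~ b)).
rewrite !big_seq; apply: eq_bigr => j; rewrite mem_iota add1n ltnS => j_n.
rewrite !big_seq; apply: eq_bigr => k; rewrite mem_iota add1n ltnS => k_n.
rewrite /F /w !nth_perm_word // /covering_inversion (eq_all_r mem_repeats_perm_word).
rewrite all_map eqb_id eqbF_neg -leqNgt; congr nat_of_bool.
have -> : all (preim (fun i => (entry pi i).-1)
    (mem [:: (entry pi k).-1; (entry pi j).-1])) (adjacencies pi) = all (mem [:: j; k]) (adjacencies pi).
  apply: eq_in_all => i; rewrite mem_adjacencies => /and3P[i0 i_n _].
  have {i0 i_n}i_n : 0 < i <= n by lia.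
  have e_pred l : 0 < l <= n -> ((entry pi i).-1 == (entry pi l).-1) = (i == l).
    move=> l_n; apply/eqP/eqP => [|->//] el; apply: entry_inj => //.
    by have := perm_entry_bounds i_n; have := perm_entry_bounds l_n; lia.
  by rewrite /= !inE !e_pred // orbC.
rewrite !andbA; congr (_ && _).
have := perm_entry_bounds j_n; have := perm_entry_bounds k_n.
case: (ltnP (entry pi k) (entry pi j)) => [kj|jk] ? ?; last by rewrite andbF; lia.
(* Given [e k < e j], the conditions [j <= d < k] and [j < k] are equivalent. *)
rewrite andbT -andbA; have [jk|kj'|jk] := ltngtP j k; last 1 first.
- by rewrite jk ltnn in kj.
- have := @inversion_across j k; lia.
- have := @entry_increasing k j; lia.
Qed.

Lemma mu1_one_descent : 2 < n ->
  mu1 pi = ((-1) ^+ n.-1 *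
    (\sum_(j <- iota 1 n) \sum_(k <- iota 1 n) covering_inversion j k)%N%:Z)%R.
Proof.
move=> n2; rewrite -normal_embeddings_perm_word /mu1 /mobius -{1 2}perm_wordK.
rewrite mu_fuel_word_perm ?size_word_perm // perm_wordK /mu1_value.
have size_neq s : size s <= 2 -> (pi == s) = false.
  by move=> s2; apply: contraTF n2 => /eqP->; rewrite -leqNgt.
by rewrite !size_neq // subrr sub0r -mulNr
  -{1}(prednK (ltnW (ltnW n2))) exprS mulN1r opprK.
Qed.
End OneDescent.

(** * Counting inversions, and entries in steps of two *)

Lemma count_lt_iota m n : 0 < m <= n.+1 -> count (fun v => v < m) (iota 1 n) = m.-1.
Proof.
case: m => // m mn; have {}mn : m <= n by lia.
by rewrite -size_filter (filter_iota_ltn 1) ?size_iota.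
Qed.

Lemma count_gt_iota m n : m <= n -> count (fun v => m < v) (iota 1 n) = n - m.
Proof.
move=> mn; have := count_predC (fun v => v < m.+1) (iota 1 n).
rewrite count_lt_iota ?size_iota; last by lia.
by rewrite (@eq_count _ (predC _) (fun v => m < v)) => [|v /=]; lia.
Qed.

Lemma count_sum (T : Type) (P : pred T) s : count P s = \sum_(x <- s) P x.
Proof. by rewrite -sum1_count big_mkcond; apply: eq_bigr => x _; case: (P x). Qed.

Lemma sum_pair_eq n i (P : pred nat) : 0 < i <= n ->
  \sum_(j <- iota 1 n) \sum_(k <- iota 1 n) ((j == i) && P k) = count P (iota 1 n).
Proof.
move=> i_n; have i_iota : i \in iota 1 n by rewrite mem_iota; lia.
rewrite (bigD1_seq i) ?iota_uniq //= eqxx [X in _ + X]big1 => [|j /negbTE ->].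
  by rewrite addn0 count_sum.
by rewrite big1.
Qed.

Section EntriesOfOneDescent.
Variables (pi : seq nat) (d : nat).
Hypotheses (pi_perm : is_perm pi) (pi_descent : descents pi = [:: d]).
Local Notation n := (size pi).
Local Notation e := (entry pi).

Let dB := descent_bounds pi_descent.
Let eB := perm_entry_bounds pi_perm.
Let inc := entry_increasing pi_perm pi_descent.
Let surj := entry_surj pi_perm.
Let same_side := consecutive_same_side pi_perm pi_descent.

Lemma count_entry (P : pred nat) :
  count (fun k => P (e k)) (iota 1 n) = count P (iota 1 n).
Proof. by rewrite -[RHS](permP pi_perm) [in RHS](entries_eq pi) count_map. Qed.

(** Of the [e i - 1] smaller values, [i - 1] stand before position [i], since the left block
    increases; the others form the inversions. *)
Lemma inversions_from_left i : 0 < i <= d ->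
  count (fun k => (i < k) && (e k < e i)) (iota 1 n) + i = e i.
Proof.
move=> i_d; have i_n : 0 < i <= n by lia.
have ei := eB i_n; have := count_entry (fun v => v < e i).
rewrite count_lt_iota; last by lia.
have := @count_lt_iota i n; rewrite !count_sum => cE.
have -> : \sum_(k <- iota 1 n) (e k < e i)
   = \sum_(k <- iota 1 n) (k < i)
     + \sum_(k <- iota 1 n) ((i < k) && (e k < e i)).
  rewrite -big_split !big_seq; apply: eq_bigr => k; rewrite mem_iota => k_n /=.
  have [ki|ik|->] := ltngtP k i; rewrite ?ltnn //.
  by rewrite inc //; lia.
rewrite cE; lia.
Qed.

(** Of the [n - e i] larger values, [n - i] stand after position [i]; the others form the
    inversions. *)
Lemma inversions_from_right i : d < i <= n ->
  count (fun j => (j < i) && (e i < e j)) (iota 1 n) + e i = i.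
Proof.
move=> i_d; have i_n : 0 < i <= n by lia.
have ei := eB i_n; have := count_entry (fun v => e i < v).
rewrite count_gt_iota; last by lia.
have := @count_gt_iota i n; rewrite !count_sum => cE.
have -> : \sum_(k <- iota 1 n) (e i < e k)
   = \sum_(k <- iota 1 n) (i < k)
     + \sum_(k <- iota 1 n) ((k < i) && (e i < e k)).
  rewrite -big_split !big_seq; apply: eq_bigr => k; rewrite mem_iota => k_n /=.
  have [ki|ik|->] := ltngtP k i; rewrite ?ltnn //.
  by rewrite inc //; lia.
rewrite cE; lia.
Qed.

(** For [j < m], the value [e j + 1] must lie right of the descent, as [j] starts no adjacency pair;
    then [e j + 2] lies left, as there is no pair on the right, and so it is the next entry. *)
Lemma left_entries m : m <= d -> {in adjacencies pi, forall k, m <= k <= d} ->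
  forall j, 0 < j <= m -> e j + (e 1 == 1) = j.*2.
Proof.
move=> md adj; have e1B : 0 < e 1 <= n by apply: eB; lia.
(* Otherwise [1] and [2] both lie after the descent and form an adjacency pair there. *)
have e1 : e 1 <= 2.
  rewrite leqNgt; apply/negP => e1.
  have [p pn pE] : exists2 i, 0 < i <= n & e i = 1 by apply: surj; lia.
  have [q qn qE] : exists2 i, 0 < i <= n & e i = 2 by apply: surj; lia.
  have dp : d < p.
    rewrite ltnNge; apply/negP => pd; have := @inc 1 p.
    by have : p != 1 by [apply/eqP => p1; move: pE; rewrite p1; lia]; lia.
  have dq : d < q.
    rewrite ltnNge; apply/negP => qd; have := @inc 1 q.
    by have : q != 1 by [apply/eqP => q1; move: qE; rewrite q1; lia]; lia.
  by have [||_ /adj] := same_side pn qn; lia.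
elim=> // j IH jm; have [->|j0] := posnP j; first by case: eqP; lia.
have {IH}ej : e j + (e 1 == 1) = j.*2 by apply: IH; lia.
suff : e j.+1 = (e j).+2 by lia.
have jn : 0 < j <= n by lia.
have j1n : 0 < j.+1 <= n by lia.
have ejB := eB jn; have ej1B := eB j1n; have ejj : e j < e j.+1 by apply: inc; lia.
have [p pn pE] : exists2 i, 0 < i <= n & e i = (e j).+1 by apply: surj; lia.
have dp : d < p.
  rewrite ltnNge; apply/negP => pd; have [|_ /adj] := same_side jn pn _ pE; lia.
have ejj2 : e j.+1 != (e j).+1.
  by apply/eqP; rewrite -pE => /(entry_inj pi_perm j1n pn); lia.
have [q qn qE] : exists2 i, 0 < i <= n & e i = (e j).+2 by apply: surj; lia.
have qd : q <= d.
  rewrite leqNgt; apply/negP => dq; have [||_ /adj] := same_side pn qn; lia.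
have [qj|jq|qj] := ltngtP q j.+1; last by rewrite -qj qE.
- have [qj'|qj'] : q = j \/ q < j by lia.
    by rewrite qj' in qE; lia.
  by have := @inc q j; lia.
- by have := @inc j.+1 q; lia.
Qed.

(** Mirror image of [left_entries], by induction on the distance [n - j] to the right end, where the
    entry is [n] or [n - 1]. *)
Lemma right_entries m : d < m -> {in adjacencies pi, forall k, d < k < m} ->
  forall j, m <= j <= n -> e j + (n - j).*2 + (e n != n) = n.
Proof.
move=> dm adj; have enB : 0 < e n <= n by apply: eB; lia.
have en : n.-1 <= e n.
  rewrite leqNgt; apply/negP => en.
  have [p pn pE] : exists2 i, 0 < i <= n & e i = n.-1 by apply: surj; lia.
  have [q qn qE] : exists2 i, 0 < i <= n & e i = n by apply: surj; lia.
  have dp : p <= d.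
    rewrite leqNgt; apply/negP => pd; have := @inc p n.
    by have : p != n by [apply/eqP => p1; move: pE; rewrite p1; lia]; lia.
  have dq : q <= d.
    rewrite leqNgt; apply/negP => qd; have := @inc q n.
    by have : q != n by [apply/eqP => q1; move: qE; rewrite q1; lia]; lia.
  by have [||_ /adj] := same_side pn qn; lia.
move=> j jB; have [k jE] : exists k, j = n - k by exists (n - j); lia.
elim: k j jE jB => [|k IH] j jE jB.
  by rewrite jE subn0 subnn addn0; case: eqP; lia.
have {IH} : e j.+1 + (n - j.+1).*2 + (e n != n) = n by apply: IH; lia.
suff : e j.+1 = (e j).+2 by lia.
have jn : 0 < j <= n by lia.
have j1n : 0 < j.+1 <= n by lia.
have ejB := eB jn; have ej1B := eB j1n; have ejj : e j < e j.+1 by apply: inc; lia.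
have [p pn pE] : exists2 i, 0 < i <= n & e i = (e j.+1).-1 by apply: surj; lia.
have dp : p <= d.
  rewrite leqNgt; apply/negP => pd; have [||/eqP] := same_side pn j1n; try lia.
  by rewrite eqSS => /eqP <- /adj; lia.
have ejj2 : e j != (e j.+1).-1.
  by apply/eqP; rewrite -pE => /(entry_inj pi_perm jn pn); lia.
have [q qn qE] : exists2 i, 0 < i <= n & e i = (e j.+1).-2 by apply: surj; lia.
have qd : d < q.
  rewrite ltnNge; apply/negP => dq; have [||_ /adj] := same_side qn pn; lia.
have [qj|jq|qj] := ltngtP q j; last by rewrite qj in qE; lia.
- by have := @inc q j; lia.
- have [qj'|qj'] : q = j.+1 \/ j.+1 < q by lia.
    by rewrite qj' in qE; lia.
  by have := @inc j.+1 q; lia.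
Qed.

End EntriesOfOneDescent.

Lemma sum_iota_bin2 (b : bool) m : \sum_(j <- iota 1 m) (j - b) = 'C(m.+1 - b, 2).
Proof.
elim: m => [|m IH]; first by rewrite big_nil; case: b.
rewrite -[in iota _ _](addn1 m) iotaD big_cat /= big_seq1 IH add1n.
by case: b {IH} => /=; rewrite ?subn1 ?subn0 [RHS]binS bin1.
Qed.

(** * The values of the Möbius function, case by case *)

Section MoebiusValues.
Variables (pi : seq nat) (d : nat).
Hypotheses (pi_perm : is_perm pi) (pi_descent : descents pi = [:: d]).
Hypothesis (size_gt2 : 2 < size pi).
Local Notation n := (size pi).
Local Notation e := (entry pi).
Local Notation covering_count :=
  (\sum_(j <- iota 1 n) \sum_(k <- iota 1 n) covering_inversion pi j k).

Lemma absz_mu1 : `|mu1 pi|%N = covering_count.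
Proof. by rewrite (mu1_one_descent pi_perm pi_descent) // abszMsign. Qed.

Lemma mu1_sign : mu1 pi = ((-1) ^+ (~~ odd n) * Posz covering_count)%R.
Proof.
rewrite (mu1_one_descent pi_perm pi_descent) // -signr_odd.
congr (_ ^+ (nat_of_bool _) * _)%R.
by case: n size_gt2 => //= m _; rewrite negbK.
Qed.

Lemma mu1_gt0 : mu1 pi != 0%R -> (0 < mu1 pi)%R = odd n.
Proof.
rewrite mu1_sign; case: (odd n); rewrite /= ?expr0 ?mul1r ?expr1 ?mulN1r; lia.
Qed.

Lemma covering_count_pairs i (P : pred nat) : 0 < i <= n ->
  (forall j k, 0 < j <= n -> 0 < k <= n -> covering_inversion pi j k = (j == i) && P k) ->
  covering_count = count P (iota 1 n).
Proof.
move=> i_n cE; rewrite -(sum_pair_eq P i_n) !big_seq; apply: eq_bigr => j.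
rewrite mem_iota add1n ltnS => j_n; rewrite !big_seq; apply: eq_bigr => k.
by rewrite mem_iota add1n ltnS => k_n; rewrite cE.
Qed.

Lemma mu1_eq0 :
  (forall j k, 0 < j -> j < k -> k <= n -> e k < e j ->
    ~~ all (mem [:: j; k]) (adjacencies pi)) ->
  mu1 pi = 0%R.
Proof.
move=> no_cover; apply/eqP; rewrite -absz_eq0 absz_mu1.
rewrite (@covering_count_pairs 1 pred0) ?count_pred0 //.
  by lia.
move=> j k /andP[j0 _] /andP[_ kn]; rewrite andbF /covering_inversion.
by apply/negP => /and3P[jk ekj]; apply/negP/no_cover.
Qed.

(** No inversion covers the border pair: none involves an initial [1], one starting at [n - 1] would
    end at the maximum [n], and one ending at [n - 1] would need the value [n] before it. *)
Lemma mu1_fixed_border :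
  ((e 1 = 1 /\ e 2 = 2) \/ (e n.-1 = n.-1 /\ e n = n)) -> mu1 pi = 0%R.
Proof.
move=> border; apply: mu1_eq0 => j k j0 jk kn kj.
have jB : 0 < e j <= n by apply: perm_entry_bounds => //; lia.
have kB : 0 < e k <= n by apply: perm_entry_bounds => //; lia.
apply/negP => /allP cover; case: border => -[b1 b2].
  have /cover : 1 \in adjacencies pi by rewrite mem_adjacencies b1 b2; lia.
  rewrite !inE => /orP[/eqP j1|]; last by lia.
  by rewrite -j1 b1 in kj; lia.
have /cover : n.-1 \in adjacencies pi.
  by rewrite mem_adjacencies !prednK ?b1 ?b2; lia.
rewrite !inE => /orP[/eqP j1|/eqP k1].
  have kE : k = n by lia.
  by rewrite -j1 kE b1 b2 in kj; lia.
have : e j = e n by rewrite b2; rewrite -k1 b1 in kj; lia.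
by move/(entry_inj pi_perm); lia.
Qed.

(** Covering the pairs at [i] and [i + 1] leaves only these two positions, which form an ascent. *)
Lemma mu1_triple_adjacency : has_triple_adjacency pi -> mu1 pi = 0%R.
Proof.
case/hasP => i; rewrite mem_iota => i_n /andP[/eqP a1 /eqP a2].
apply: mu1_eq0 => j k j0 jk kn kj; apply/negP => /allP cover.
have /cover : i \in adjacencies pi by rewrite mem_adjacencies a1 eqxx; lia.
have /cover : i.+1 \in adjacencies pi by rewrite mem_adjacencies a1 a2 eqxx; lia.
rewrite !inE => h1 h2; have [ji ki] : j = i /\ k = i.+1 by lia.
by rewrite ji ki a1 in kj; lia.
Qed.

Lemma mu1_many_adjacencies : 2 < size (adjacencies pi) -> mu1 pi = 0%R.
Proof.
move=> sz; apply: mu1_eq0 => j k _ _ _ _; apply: contraTN sz => /allP cover.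
rewrite -leqNgt; apply: (@uniq_leq_size _ _ [:: j; k]) => //.
by rewrite filter_uniq ?iota_uniq.
Qed.

Lemma adjacencies_pair i j : adjacencies pi = [:: i; j] -> 0 < i /\ i < j < n.
Proof.
move=> aE; have : sorted ltn (adjacencies pi).
  by rewrite sorted_filter ?iota_ltn_sorted //; apply: ltn_trans.
have : i \in adjacencies pi by rewrite aE inE eqxx.
have : j \in adjacencies pi by rewrite aE !inE eqxx orbT.
by rewrite !mem_adjacencies aE /=; lia.
Qed.

(** The only candidate is [(i, j)], and it counts exactly when it is an inversion. *)
Lemma mu1_two_adjacencies i j : adjacencies pi = [:: i; j] ->
  (e j < e i -> `|mu1 pi|%N = 1) /\ (e i < e j -> mu1 pi = 0%R).
Proof.
move=> aE; have [i0 /andP[ij jn]] := adjacencies_pair aE; split=> eij.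
  rewrite absz_mu1 (@covering_count_pairs i (pred1 j)) => [||j' k' j'n k'n]; last 2 first.
  - by lia.
  - rewrite /covering_inversion aE /= !inE.
    apply/and3P/andP => [[jk _ h]|[/eqP-> /eqP->]]; first by split; apply/eqP; lia.
    by split=> //; rewrite !eqxx orbT.
  by rewrite count_uniq_mem ?iota_uniq // mem_iota; lia.
apply: mu1_eq0 => j' k' j0 jk kn; apply: contraTN; rewrite aE /= !inE => h.
have [-> ->] : j' = i /\ k' = j by lia.
by rewrite -leqNgt ltnW.
Qed.

(** An inversion covering [i] must begin there, as its later end lies after the descent. There are
    [e i - i] of them, and [e i] is [2i] or [2i - 1]. *)
Lemma mu1_one_adjacency_left i : adjacencies pi = [:: i] -> i < d ->
  `|mu1 pi|%N = i - (e 1 == 1).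
Proof.
move=> aE id; have : i \in adjacencies pi by rewrite aE inE.
have dB := descent_bounds pi_descent.
rewrite mem_adjacencies => /and3P[i0 i_n _].
have countE : covering_count = count (fun k => (i < k) && (e k < e i)) (iota 1 n).
  apply: (@covering_count_pairs i) => [|j k jn kn]; first by lia.
  rewrite /covering_inversion aE /= !inE andbT.
  apply/and3P/andP => [[jk kj /orP[/eqP ji|/eqP ki]]|[/eqP-> /andP[-> ->]]].
  - by rewrite ji eqxx jk kj.
  - by have := @inversion_across pi d pi_perm pi_descent j k; lia.
  - by rewrite eqxx.
rewrite absz_mu1 countE.
have := @inversions_from_left pi d pi_perm pi_descent i.
have := @left_entries pi d pi_perm pi_descent i (ltnW id).
move=> le; have /le/(_ i) : {in adjacencies pi, forall k, i <= k <= d}.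
  by move=> k; rewrite aE inE => /eqP->; lia.
lia.
Qed.

Lemma mu1_one_adjacency_right i : adjacencies pi = [:: i] -> d < i ->
  `|mu1 pi|%N = n - i - (e n == n).
Proof.
move=> aE id; have : i \in adjacencies pi by rewrite aE inE.
have dB := descent_bounds pi_descent.
rewrite mem_adjacencies => /and3P[i0 i_n /eqP iE].
have countE : covering_count = count (fun j => (j < i) && (e i < e j)) (iota 1 n).
  rewrite exchange_big -(@sum_pair_eq n i) /=; last by lia.
  rewrite !big_seq; apply: eq_bigr => k; rewrite mem_iota => kn.
  rewrite !big_seq; apply: eq_bigr => j; rewrite mem_iota => jn.
  rewrite /covering_inversion aE /= !inE andbT; congr nat_of_bool.
  apply/and3P/andP => [[jk kj /orP[/eqP ji|/eqP ki]]|[/eqP-> /andP[-> ->]]].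
  - by have := @inversion_across pi d pi_perm pi_descent j k; lia.
  - by rewrite ki eqxx jk kj.
  - by rewrite eqxx orbT.
rewrite absz_mu1 countE.
have := @inversions_from_right pi d pi_perm pi_descent i.
(* The steps of two reach back only to [i + 1]; the adjacency pair [iE] then gives [e i], and
   [i - e i] inversions end at [i]. *)
have := @right_entries pi d pi_perm pi_descent i.+1 (ltnW id).
move=> re; have /re/(_ i.+1) : {in adjacencies pi, forall k, d < k < i.+1}.
  by move=> k; rewrite aE inE => /eqP->; lia.
have : 0 < e n <= n by apply: perm_entry_bounds => //; lia.
case: eqP; lia.
Qed.

(** Every inversion counts, and [e j - j = j - (e 1 == 1)] of them begin at each [j <= d]. The
    bounds say that [e d] is [n - 1] or [n]: otherwise these two values would be adjacent on the
    right. They determine [d] from [n] and [e 1]. *)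
Lemma mu1_no_adjacency : adjacencies pi = [::] ->
  `|mu1 pi|%N = 'C(d.+1 - (e 1 == 1), 2) /\ n.-1 <= d.*2 - (e 1 == 1) <= n.
Proof.
move=> aE; have dB := descent_bounds pi_descent.
have le := @left_entries pi d pi_perm pi_descent d (leqnn d).
have {}le j : 0 < j <= d -> e j + (e 1 == 1) = j.*2.
  by apply: le => k; rewrite aE.
have ed : e d + (e 1 == 1) = d.*2 by apply: le; lia.
have edB : 0 < e d <= n by apply: perm_entry_bounds => //; lia.
split; last first.
  suff : n.-1 <= e d by lia.
  rewrite leqNgt; apply/negP => edn.
  have [p pn pE] : exists2 i, 0 < i <= n & e i = n.-1 by apply: entry_surj => //; lia.
  have [q qn qE] : exists2 i, 0 < i <= n & e i = n by apply: entry_surj => //; lia.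
  have right r : 0 < r <= n -> e d < e r -> d < r.
    move=> rn; apply: contraTT; rewrite -!leqNgt leq_eqVlt => /predU1P[->//|rd].
    by rewrite ltnW // (entry_increasing pi_perm pi_descent) //; lia.
  have dp := right p pn; have dq := right q qn.
  have [||_] := consecutive_same_side pi_perm pi_descent pn qn; try lia.
  by rewrite aE.
rewrite absz_mu1.
transitivity (\sum_(j <- iota 1 n) (if j <= d then j - (e 1 == 1) else 0)).
  rewrite !big_seq; apply: eq_bigr => j; rewrite mem_iota => jn.
  under eq_bigr do rewrite /covering_inversion aE /= andbT.
  case: leqP => jd.
    have := @inversions_from_left pi d pi_perm pi_descent j; rewrite count_sum.
    have := le j; lia.
  rewrite big_seq big1 // => k; rewrite mem_iota => kn.
  have := @inversion_across pi d pi_perm pi_descent j k; lia.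
have {1}-> : n = d + (n - d) by lia.
rewrite iotaD big_cat /= [X in _ + X]big_seq [X in _ + X]big1 ?addn0; last first.
  by move=> j; rewrite mem_iota [j <= d]leqNgt => /andP[-> _].
rewrite big_seq; under eq_bigr => j jd.
  rewrite ifT; last by move: jd; rewrite mem_iota; lia.
  over.
by rewrite -big_seq sum_iota_bin2.
Qed.

End MoebiusValues.

Theorem mainTheorem10 (pi : seq nat) :
  is_perm pi -> 2 < size pi -> size (descents pi) = 1 ->
  let n := size pi in
  (* (1) *)
  (mu1 pi != 0%R -> (0 < mu1 pi)%R = odd n) /\
  (* (2) *)
  ((entry pi 1 = 1 /\ entry pi 2 = 2) \/ (entry pi n.-1 = n.-1 /\ entry pi n = n) ->
     mu1 pi = 0%R) /\
  (* (3) *)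
  (has_triple_adjacency pi -> mu1 pi = 0%R) /\
  (* (4) *)
  (2 < size (adjacencies pi) -> mu1 pi = 0%R) /\
  (* (5) *)
  (forall i j, adjacencies pi = [:: i; j] ->
     (entry pi j < entry pi i -> `|mu1 pi|%N = 1) /\
     (entry pi i < entry pi j -> mu1 pi = 0%R)) /\
  (* (6) *)
  (forall i d, adjacencies pi = [:: i] -> descents pi = [:: d] ->
     (i < d -> entry pi 1 != 1 -> `|mu1 pi|%N = i) /\
     (i < d -> entry pi 1 = 1 -> `|mu1 pi|%N = i.-1) /\
     (d < i -> entry pi n != n -> `|mu1 pi|%N = n - i) /\
     (d < i -> entry pi n = n -> `|mu1 pi|%N = n - i - 1)) /\
  (* (7) *)
  (adjacencies pi = [::] ->
     (~~ odd n -> entry pi 1 = 1 -> mu1 pi = (- Posz ('C(n./2, 2)))%R) /\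
     (~~ odd n -> entry pi 1 = 2 -> mu1 pi = (- Posz ('C(n./2 + 1, 2)))%R) /\
     (odd n -> mu1 pi = Posz ('C((n + 1)./2, 2)))).
Proof.
move=> pi_perm n2; case dE: (descents pi) => [|d [|? ?]] // _ /=.
split; first exact: mu1_gt0 dE n2.
split; first exact: mu1_fixed_border dE n2.
split; first exact: mu1_triple_adjacency dE n2.
split; first exact: mu1_many_adjacencies dE n2.
split; first by move=> i j; apply: mu1_two_adjacencies dE n2 i j.
split=> [i d' aE [<-]|aE].
  have left_i := mu1_one_adjacency_left pi_perm dE n2 aE.
  have right_i := mu1_one_adjacency_right pi_perm dE n2 aE.
  split; first by move=> /left_i-> /negbTE->; rewrite subn0.
  split; first by move=> /left_i-> ->; rewrite subn1.
  split; first by move=> /right_i-> /negbTE->; rewrite subn0.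
  by move=> /right_i-> ->; rewrite eqxx.
have [absE dn] := mu1_no_adjacency pi_perm dE n2 aE.
rewrite (mu1_sign pi_perm dE n2) -(absz_mu1 pi_perm dE n2) absE.
split=> [n_even e1|]; last split=> [n_even e1|n_odd].
- by rewrite n_even mulN1r; congr (- (Posz 'C(_, 2)))%R; move: dn; rewrite e1 /=; lia.
- by rewrite n_even mulN1r; congr (- (Posz 'C(_, 2)))%R; move: dn; rewrite e1 /=; lia.
(* For odd [n], [d] is [(n + 1) / 2] if [e 1 = 1] and [(n - 1) / 2] otherwise; the upper index is
   [(n + 1) / 2] in both cases. *)
- by rewrite n_odd mul1r; congr (Posz 'C(_, 2)); move: dn; case: (_ == _); lia.
Qed.
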